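(* Let $n\geq 3$ be odd, let $k\geq 1$ be an integer, let $G=F^{k}(n)$ and let $w(n,k)=x_0^kx_1^k\cdots x_{n-1}^k\in G$. Then the normal closure of $w(n,k)$ in $G$ is equal to the derived subgroup of $G$. Thus $w(n,k)=1$ in $G$ if and only if $G$ is abelian. In particular, $G$ is not torsion-free.
   Context: For integers $n,k\geq 1$, $$F^{k}(n)=\langle x_0,\ldots,x_{n-1}\mid x_i x_{i+1}^k=x_{i+2}\ (0\leq i<n)\rangle,$$ with subscripts taken modulo $n$. A group is torsion-free if it has no non-trivial element of finite order. *)

(* Defs.v *)
From HB Require Import structures.
From mathcomp Require Import all_boot generic_quotient.
From mathcomp Require Import boolp classical_sets.

Set Implicit Arguments.
Unset Strict Implicit.
Unset Printing Implicit Defensive.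

Local Open Scope classical_set_scope.
Local Open Scope quotient_scope.
Local Open Scope group_scope.

Section Presentation.
Variable T : choiceType.

(* The letter (t, false) stands for the generator t, (t, true) for t^-1. *)
Definition word := seq (T * bool).

Definition word_inv (u : word) : word := rev [seq (a.1, ~~ a.2) | a <- u].

Variable R : word -> word -> Prop.

(* Equality in < T | u = v whenever R u v >: the smallest congruence on words
   that contains the relations and the free cancellations. *)
Inductive pres_eq : word -> word -> Prop :=
| pres_rel u v : R u v -> pres_eq u v
| pres_cancel t b : pres_eq [:: (t, b); (t, ~~ b)] [::]
| pres_refl u : pres_eq u u
| pres_sym u v : pres_eq u v -> pres_eq v u
| pres_trans u v w : pres_eq u v -> pres_eq v w -> pres_eq u w
| pres_cat u u' v v' : pres_eq u u' -> pres_eq v v' ->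
    pres_eq (u ++ v) (u' ++ v').

Definition pres_eqb : rel word := fun u v => `[< pres_eq u v >].

Lemma pres_eqb_refl : reflexive pres_eqb.
Proof. by move=> u; apply/asboolP; exact: pres_refl. Qed.

Lemma pres_eqb_sym : symmetric pres_eqb.
Proof. by move=> u v; apply/asboolP/asboolP; exact: pres_sym. Qed.

Lemma pres_eqb_trans : transitive pres_eqb.
Proof.
move=> v u w /asboolP uv /asboolP vw; apply/asboolP; exact: pres_trans vw.
Qed.

Canonical pres_equiv := EquivRel pres_eqb pres_eqb_refl pres_eqb_sym
  pres_eqb_trans.

Definition presented := {eq_quot pres_equiv}.

HB.instance Definition _ := Choice.on presented.

Definition pres_class (u : word) : presented := \pi_({eq_quot pres_equiv}) u.

Lemma pres_classP u v : pres_class u = pres_class v <-> pres_eq u v.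
Proof.
split=> [/eqP|uv]; first by rewrite eqmodE => /asboolP.
by apply/eqP; rewrite eqmodE; apply/asboolP.
Qed.

Definition pres_repr (g : presented) : word := repr g.

Lemma pres_reprK : cancel pres_repr pres_class.
Proof. by move=> g; rewrite /pres_class reprK. Qed.

Lemma pres_class_repr u : pres_eq (pres_repr (pres_class u)) u.
Proof. by apply/pres_classP; rewrite pres_reprK. Qed.

Definition pres_one : presented := pres_class [::].
Definition pres_mul (g h : presented) : presented :=
  pres_class (pres_repr g ++ pres_repr h).
Definition pres_inv (g : presented) : presented :=
  pres_class (word_inv (pres_repr g)).

Lemma pres_class_cat u v :
  pres_class (u ++ v) = pres_mul (pres_class u) (pres_class v).
Proof.
by apply/pres_classP; apply: pres_sym; apply: pres_cat; exact: pres_class_repr.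
Qed.

Lemma pres_eq_mulV u : pres_eq (u ++ word_inv u) [::].
Proof.
elim: u => [|[t b] u IHu]; first exact: pres_refl.
have -> : ((t, b) :: u) ++ word_inv ((t, b) :: u) =
    [:: (t, b)] ++ ((u ++ word_inv u) ++ [:: (t, ~~ b)]).
  by rewrite /word_inv map_cons rev_cons -cats1 -!catA.
apply: pres_trans (pres_cancel t b); apply: (@pres_cat [:: _] [:: _]).
  exact: pres_refl.
by apply: (@pres_cat _ [::]); [exact: IHu | exact: pres_refl].
Qed.

Lemma word_invK : involutive word_inv.
Proof.
move=> u; rewrite /word_inv map_rev revK -map_comp map_id_in // => -[t b] _ /=.
by rewrite negbK.
Qed.

Lemma pres_mulA : associative pres_mul.
Proof.
move=> g h l; rewrite -[g]pres_reprK -[h]pres_reprK -[l]pres_reprK.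
by rewrite -!pres_class_cat catA.
Qed.

Lemma pres_mul1g : left_id pres_one pres_mul.
Proof. by move=> g; rewrite -[g]pres_reprK -pres_class_cat. Qed.

Lemma pres_mulg1 : right_id pres_one pres_mul.
Proof. by move=> g; rewrite -[g]pres_reprK -pres_class_cat cats0. Qed.

Lemma pres_mulgV : right_inverse pres_one pres_inv pres_mul.
Proof.
move=> g; rewrite -{1}[g]pres_reprK -pres_class_cat.
by apply/pres_classP; exact: pres_eq_mulV.
Qed.

Lemma pres_mulVg : left_inverse pres_one pres_inv pres_mul.
Proof.
move=> g; rewrite -{2}[g]pres_reprK -pres_class_cat; apply/pres_classP.
by rewrite -{2}(word_invK (pres_repr g)); exact: pres_eq_mulV.
Qed.

HB.instance Definition _ := isGroup.Build presented
  pres_mulA pres_mul1g pres_mulg1 pres_mulVg pres_mulgV.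

Definition pres_gen (t : T) : presented := pres_class [:: (t, false)].

End Presentation.

(* Von Dyck: the universal property of the presentation. *)
Section VonDyck.
Variables (T : choiceType) (R : word T -> word T -> Prop).
Variables (H : groupType) (f : T -> H).

Definition word_eval (u : word T) : H :=
  \prod_(a <- u) (if a.2 then (f a.1)^-1 else f a.1).

Hypothesis fR : forall u v, R u v -> word_eval u = word_eval v.

Lemma pres_eq_eval u v : pres_eq R u v -> word_eval u = word_eval v.
Proof.
elim=> {u v} //.
- move=> t [] /=; rewrite /word_eval big_cons big_seq1 big_nil /=.
    exact: mulVg.
  exact: mulgV.
- by move=> u v w _ -> _ ->.
by move=> u u' v v' _ Eu _ Ev; rewrite /word_eval !big_cat; congr (_ * _).
Qed.

Definition pres_lift (g : presented R) : H := word_eval (pres_repr g).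

Lemma pres_lift_class u : pres_lift (pres_class R u) = word_eval u.
Proof. by apply: pres_eq_eval; exact: pres_class_repr. Qed.

Lemma pres_lift_gen t : pres_lift (pres_gen R t) = f t.
Proof. by rewrite pres_lift_class /word_eval big_seq1. Qed.

Lemma pres_liftM : {morph pres_lift : g h / g * h}.
Proof. by move=> g h; rewrite pres_lift_class /word_eval big_cat. Qed.

End VonDyck.

Section Subgroups.
Variable G : groupType.

Definition is_subgroup (H : set G) : Prop :=
  [/\ H 1, forall x y, H x -> H y -> H (x * y) & forall x, H x -> H x^-1].

Definition is_normal_subgroup (N : set G) : Prop :=
  is_subgroup N /\ forall x g, N x -> N (x ^ g).

Definition normal_closure (A : set G) : set G := smallest is_normal_subgroup A.

Definition derived_subgroup : set G :=
  smallest is_subgroup [set z | exists x y, z = [~ x, y]].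

Definition is_abelian : Prop := forall x y : G, x * y = y * x.

Definition torsion_free : Prop :=
  forall (x : G) (m : nat), (0 < m)%N -> x ^+ m = 1 -> x = 1.

End Subgroups.

Arguments derived_subgroup : clear implicits.

Section FibonacciGroup.
Variables k n : nat.

(* x_i x_{i+1}^k = x_{i+2}; ordS is the successor modulo n. *)
Definition fib_rel (u v : word 'I_n) : Prop := exists i : 'I_n,
  u = (i, false) :: nseq k (ordS i, false) /\ v = [:: (ordS (ordS i), false)].

Definition fib_group : groupType := presented fib_rel.

Definition fib_gen (i : 'I_n) : fib_group := pres_gen fib_rel i.

Lemma fib_gen_rel i :
  fib_gen i * fib_gen (ordS i) ^+ k = fib_gen (ordS (ordS i)).
Proof.
have -> : fib_gen (ordS i) ^+ k = pres_class fib_rel (nseq k (ordS i, false)).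
  elim: k => [//|m IHm]; rewrite expgS IHm.
  exact: esym (@pres_class_cat _ fib_rel [:: _] _).
rewrite -[LHS](@pres_class_cat _ fib_rel [:: _] _).
by apply/pres_classP/pres_rel; exists i.
Qed.

Definition fib_w : fib_group := \prod_(i < n) fib_gen i ^+ k.

End FibonacciGroup.

(* Main.v *)
(* Since x_{i+1}^k = x_i^-1 x_{i+2}, induction on m gives
     x_0 (x_1^k x_2^k ... x_{2m}^k) = x_1^-1 x_{2m+1} x_{2m}.
   For 2m + 1 = n this says that w is conjugate to [x_0, x_1]; as x_0 and x_1
   generate G, the normal closure of w is G'.  For m = n it says that
   x_1^k ... x_{n-1}^k x_0^k, a conjugate of w, has square 1.  So w is a torsion
   element unless w = 1, in which case G is abelian, and then its generators
   have order dividing f_{n-1} + f_{n+1}, where f is the generalized Fibonacci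
   sequence f_{i+2} = k f_{i+1} + f_i; one of them is nontrivial because it is
   sent to f_n in a cyclic quotient of order f_{n-1} + f_{n+1} > f_n. *)
Require Import Defs.
From mathcomp Require Import all_boot.
From mathcomp Require Import boolp classical_sets.
From mathcomp Require Import fingroup ssralg zmodp ring zify.

Set Implicit Arguments.
Unset Strict Implicit.
Unset Printing Implicit Defensive.

Local Open Scope classical_set_scope.
Local Open Scope group_scope.

(** * Derived subgroup and commutators modulo a normal subgroup *)

Section Sub.
Variable G : groupType.
Implicit Types N H : set G.

Lemma derived_sub_normal N :
  is_normal_subgroup N -> (forall x y : G, N [~ x, y]) ->
  derived_subgroup G `<=` N.
Proof.
by move=> [subN _] comN; apply: smallest_sub => // _ [x [y ->]].
Qed.

Lemma derived_comm (x y : G) : derived_subgroup G [~ x, y].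
Proof. by apply: sub_gen_smallest; exists x, y. Qed.

Lemma derived_is_subgroup : is_subgroup (derived_subgroup G).
Proof.
split=> [|x y Dx Dy|x Dx] H clH; have [[H1 HM HV] _] := clH => //.
- exact: HM (Dx _ clH) (Dy _ clH).
- exact: HV (Dx _ clH).
Qed.

Lemma derived_normal : is_normal_subgroup (derived_subgroup G).
Proof.
have [D1 DM DV] := derived_is_subgroup.
split=> // x g Dx.
suff: derived_subgroup G `<=` [set z | derived_subgroup G (z ^ g)] by exact.
apply: smallest_sub => [|_ [y [z ->]] /=]; last first.
  by rewrite conjRg; exact: derived_comm.
split=> /= [|y z|y]; first by rewrite conj1g.
- by rewrite conjMg; exact: DM.
- by rewrite conjVg; exact: DV.
Qed.

Lemma is_normal_subgroup1 : is_normal_subgroup [set 1 : G].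
Proof.
split; last by move=> x g /= ->; rewrite conj1g.
by split=> // [x y -> ->|x ->] /=; rewrite ?mulg1 ?invg1.
Qed.

(** Normality of [N] absorbs the conjugations in [x, yz] = [x, z] [x, y]^z and in the formula for
    [x, y^-1]. Hence commuting with [x] modulo [N] can be tested on generators. *)
Lemma comm_subgroup N (x : G) :
  is_normal_subgroup N -> is_subgroup [set y | N [~ x, y]].
Proof.
move=> [[N1 NM NV] NJ]; split=> /= [|y z Ny Nz|y Ny].
- by rewrite commg1.
- have -> : [~ x, y * z] = [~ x, z] * [~ x, y] ^ z.
    by rewrite !commgEl !conjgE invgM !mulgA !mulgK.
  by apply: NM => //; exact: NJ.
- have -> : [~ x, y^-1] = [~ x, y]^-1 ^ y^-1.
    by rewrite invgR !commgEl !conjgE !invgK !mulgA mulgV mul1g.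
  by apply/NJ/NV.
Qed.

End Sub.

Lemma presented_subgroup (T : choiceType) (R : word T -> word T -> Prop)
    (H : set (presented R)) :
  is_subgroup H -> (forall t, H (pres_gen R t)) -> forall g, H g.
Proof.
move=> [H1 HM HV] Hgen g; rewrite -[g]pres_reprK.
elim: (pres_repr g) => [//|[t b] u IHu].
have -> : pres_class R ((t, b) :: u) =
    pres_class R [:: (t, b)] * pres_class R u.
  exact: (@pres_class_cat _ R [:: (t, b)]).
apply: HM => //; case: b; last exact: Hgen.
suff -> : pres_class R [:: (t, true)] = (pres_gen R t)^-1 by apply/HV/Hgen.
apply: (mulIg (pres_gen R t)); rewrite mulVg.
rewrite -[LHS](@pres_class_cat _ R [:: (t, true)]).
by apply/pres_classP; exact: (pres_cancel R t true).
Qed.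

(** * Generalized Fibonacci numbers *)

Fixpoint kfib_pair (k i : nat) : nat * nat :=
  if i is j.+1 then let: (a, b) := kfib_pair k j in (b, (k * b + a)%N)
  else (0%N, 1%N).

Definition kfib k i := (kfib_pair k i).1.

Lemma kfibSS k i : kfib k i.+2 = (k * kfib k i.+1 + kfib k i)%N.
Proof. by rewrite /kfib /=; case: kfib_pair. Qed.

Lemma kfib_gt0 k i : (0 < k)%N -> (0 < kfib k i.+1)%N.
Proof.
by move=> k0; elim: i => [//|i IHi]; rewrite kfibSS addn_gt0 muln_gt0 k0 IHi.
Qed.

(** Cassini's identity for the parity in which the sign allows a statement without subtraction. *)
Lemma kfib_cassini k m :
  (kfib k m.*2 * kfib k m.*2.+2 + 1 = kfib k m.*2.+1 ^ 2)%N.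
Proof.
elim: m => [|m]; first by rewrite !kfibSS /kfib /=; lia.
by rewrite doubleS (kfibSS k m.*2.+2) (kfibSS k m.*2.+1) (kfibSS k m.*2); nia.
Qed.

(** * Sequences in a group that satisfy the Fibonacci relation *)

Section FibSequence.
Variables (H : groupType) (k : nat) (x : nat -> H).
Hypothesis xS : forall i, x i * x i.+1 ^+ k = x i.+2.

Lemma fib_seq_prod m :
  x 0 * \prod_(i < m.*2) x i.+1 ^+ k = (x 1)^-1 * x m.*2.+1 * x m.*2.
Proof.
elim: m => [|m IHm]; first by rewrite big_ord0 mulg1 mulVg mul1g.
rewrite doubleS !big_ord_recr /= !mulgA IHm -!mulgA (mulgA (x m.*2)) xS.
(* Since x_{2m+2} commutes with its own k-th power, that power can be moved next to x_{2m+1}, where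
   the relation gives x_{2m+3}. *)
by rewrite -expgS expgSr -[in RHS]xS !mulgA.
Qed.

Lemma fib_seq_comm i : commute (x 0) (x 1) ->
  x i.+1 = x 0 ^+ kfib k i * x 1 ^+ kfib k i.+1.
Proof.
move=> cx.
have cX a b : commute (x 0 ^+ a) (x 1 ^+ b) by apply/commuteX2.
suff [] : x i.+1 = x 0 ^+ kfib k i * x 1 ^+ kfib k i.+1 /\
          x i.+2 = x 0 ^+ kfib k i.+1 * x 1 ^+ kfib k i.+2 by [].
elim: i => [|i [IH1 IH2]].
  by rewrite -xS kfibSS /kfib /= !muln1 addn0 !expg1 mul1g.
split=> //; rewrite -xS IH1 [in LHS]IH2 expgMn; last exact: cX.
rewrite -!expgM mulgA -[_ * x 0 ^+ _]mulgA -cX mulgA -expgnDr -mulgA -expgnDr.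
rewrite (kfibSS k i.+1) (kfibSS k i).
by congr (_ ^+ _ * _ ^+ _); lia.
Qed.

(** Put n = 2m + 1 and a, b, c = f_{n-1}, f_n, f_{n+1}. Periodicity gives x_0 = x_0^a x_1^b and x_1
    = x_0^b x_1^c. Compare the c-th power of the first with the b-th power of the second: as b^2 =
    ac + 1, x_1^b = x_0^(c+1), and the first equation becomes x_0 = x_0^(a+c+1). *)
Lemma fib_seq_torsion m : commute (x 0) (x 1) ->
    (forall i, x (i + m.*2.+1)%N = x i) ->
  x 0 ^+ (kfib k m.*2 + kfib k m.*2.+2) = 1.
Proof.
move=> cx xn.
have cX a b : commute (x 0 ^+ a) (x 1 ^+ b) by apply/commuteX2.
have E0 := fib_seq_comm m.*2 cx; have E1 := fib_seq_comm m.*2.+1 cx.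
rewrite -[m.*2.+1]add0n xn add0n in E0; rewrite -add1n xn in E1.
have := kfib_cassini k m.
move: E0 E1; set a := kfib k m.*2; set b := kfib _ _; set c := kfib _ _.
move=> E0 E1 D.
have F0 : x 0 ^+ c = x 0 ^+ (a * c) * x 1 ^+ (b * c).
  by rewrite [in LHS]E0 expgMn ?expgM.
have F1 : x 1 ^+ b = x 0 ^+ (b ^ 2) * x 1 ^+ (b * c).
  by rewrite [in LHS]E1 expgMn -?expgM 1?(mulnC c).
have F2 : x 1 ^+ b = x 0 ^+ c.+1.
  by rewrite F1 -D addn1 expgS -mulgA -F0 -expgS.
by apply: (mulgI (x 0)); rewrite -expgS mulg1 [RHS]E0 F2 -expgnDr addnS.
Qed.

End FibSequence.

(** * The group for n = 2m + 1, its two generators and the element w *)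

Section FibGroup.
Variables k m : nat.
Let n := m.*2.+1.
Local Notation G := (fib_group k n).

Definition fib_x (i : nat) : G := fib_gen k (inord (i %% n) : 'I_n).

Lemma ordS_inord i : ordS (inord (i %% n) : 'I_n) = inord (i.+1 %% n).
Proof.
apply/val_inj; rewrite /= !inordK ?ltn_pmod //.
by rewrite -addn1 modnDml addn1.
Qed.

Lemma fib_xS i : fib_x i * fib_x i.+1 ^+ k = fib_x i.+2.
Proof. by rewrite /fib_x -!ordS_inord fib_gen_rel. Qed.

Lemma fib_xDn i : fib_x (i + n) = fib_x i.
Proof. by rewrite /fib_x modnDr. Qed.

Lemma fib_x_ord (i : 'I_n) : fib_x i = fib_gen k i.
Proof. by rewrite /fib_x modn_small // inord_val. Qed.

Lemma fib_group_gen2 (H : set G) :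
  is_subgroup H -> H (fib_x 0) -> H (fib_x 1) -> forall g, H g.
Proof.
move=> sH H0 H1; have [H_1 HM HV] := sH.
have HX g j : H g -> H (g ^+ j).
  by move=> Hg; elim: j => [//|j IHj]; rewrite expgS; exact: HM.
have Hx i : H (fib_x i) /\ H (fib_x i.+1).
  by elim: i => [//|i [IH1 IH2]]; split=> //; rewrite -fib_xS; apply/HM/HX.
apply: presented_subgroup => // t.
by rewrite -/(fib_gen k t) -fib_x_ord; case: (Hx t).
Qed.

(** Two passes through the generators: first [fib_x 0] and [fib_x 1] are central modulo [N], then
    every [g] is. *)
Lemma fib_comm_normal (N : set G) : is_normal_subgroup N ->
  N [~ fib_x 0, fib_x 1] -> forall g h, N [~ g, h].
Proof.
move=> nN N01; have [[N1 NM NV] _] := nN.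
have Nsym g h : N [~ g, h] -> N [~ h, g] by move=> /NV; rewrite invgR.
have N00 (g : G) : N [~ g, g] by rewrite commgg.
have Nx h : N [~ fib_x 0, h] /\ N [~ fib_x 1, h].
  split; apply: (fib_group_gen2 (comm_subgroup _ nN)) => //=; exact: Nsym.
move=> g h; apply: (fib_group_gen2 (comm_subgroup g nN)) => /=;
  by apply: Nsym; case: (Nx g).
Qed.

Lemma fib_wE : fib_w k n = \prod_(i < n) fib_x i ^+ k.
Proof. by apply: eq_bigr => i _; rewrite fib_x_ord. Qed.

Lemma fib_w_comm :
  fib_w k n ^ (fib_x 0 ^+ k) = [~ fib_x 0, fib_x 1].
Proof.
(* This conjugation moves the first factor x_0^k of w to the end, where x_{n-1} x_n^k = x_{n+1} will
   apply. *)
rewrite fib_wE big_ord_recl /= conjgE -!mulgA mulKg commgEl conjgE.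
apply: (mulgI (fib_x 0)); rewrite !mulgA (fib_seq_prod fib_xS) mulgV mul1g.
rewrite -[m.*2.+1]add0n fib_xDn -!mulgA; congr (_ * (_ * _)).
by rewrite -(fib_xDn 0) -(fib_xDn 1) add0n add1n fib_xS.
Qed.

Lemma fib_w_sqr : fib_w k n ^+ 2 = 1.
Proof.
apply: (conjg_inj (fib_x 0 ^+ k)); rewrite conj1g expg2 conjMg.
have wJ : fib_w k n ^ (fib_x 0 ^+ k) = \prod_(i < n) fib_x i.+1 ^+ k.
  rewrite fib_wE big_ord_recl conjgE -!mulgA mulKg [RHS]big_ord_recr /=.
  by congr (_ * _ ^+ k); rewrite -[m.*2.+1]add0n fib_xDn.
(* With 2n factors the indices run twice round the cycle, and the right-hand side collapses to
   x_0. *)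
have := fib_seq_prod fib_xS n; rewrite -addnn big_split_ord /= -wJ.
have -> : \prod_(i < n) fib_x (n + i).+1 ^+ k = fib_w k n ^ (fib_x 0 ^+ k).
  by rewrite wJ; apply: eq_bigr => i _; rewrite -addnS addnC fib_xDn.
have -> : fib_x (n + n).+1 = fib_x 1 by rewrite -addSn -add1n !fib_xDn.
have -> : fib_x (n + n) = fib_x 0 by rewrite -[n in (n + _)%N]add0n !fib_xDn.
by rewrite mulVg mul1g => E; apply: (mulgI (fib_x 0)); rewrite mulg1.
Qed.

(** * A cyclic quotient in which x_{n-1} survives *)

Section Cyclic.
Import GRing.Theory.
Local Open Scope ring_scope.
Hypotheses (k_gt0 : (0 < k)%N) (m_gt0 : (0 < m)%N).

Let L := (kfib k m.*2 + kfib k m.*2.+2)%N.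

Lemma cyclic_order_gt : (kfib k m.*2.+1 < L)%N.
Proof.
rewrite /L kfibSS; have : (0 < kfib k m.*2)%N.
  by case: m m_gt0 => // j _; rewrite doubleS kfib_gt0.
by nia.
Qed.

Let L_gt1 : (1 < L)%N.
Proof. by apply: leq_ltn_trans cyclic_order_gt; exact: kfib_gt0. Qed.

(* [(f_n, 1 - f_(n-1))] is fixed, modulo [L], by the [n]-th power of the
   matrix of the recurrence. *)
Let c (i : nat) : 'Z_L :=
  (kfib k i)%:R * (kfib k m.*2.+1)%:R
    + (kfib k i.+1)%:R * (1 - (kfib k m.*2)%:R).

Let cS i : c i + k%:R * c i.+1 = c i.+2.
Proof. by rewrite /c (kfibSS k i.+1) (kfibSS k i) !(natrD, natrM); ring. Qed.

Let c_last : c m.*2 = (kfib k m.*2.+1)%:R.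
Proof. by rewrite /c; ring. Qed.

Let c_n : c n = c 0%N.
Proof.
have L0 : (L%:R : 'Z_L) = 0 by apply: pchar_Zp.
have D : (kfib k m.*2 * kfib k m.*2.+2 + 1)%:R =
    (kfib k m.*2.+1 ^ 2)%:R :> 'Z_L.
  by rewrite kfib_cassini.
rewrite /c /n -[kfib k 0]/0%N -[kfib k 1]/1%N.
move: L0 D; rewrite /L !natrD natrM natrX => L0 D.
(* By Cassini's identity the two sides differ by exactly f_{n-1} + f_{n+1} = [L]. *)
rewrite -expr2 -D -[RHS]addr0 -L0; ring.
Qed.

Let cDn i : c (i + n) = c i.
Proof.
suff [] : c (i + n) = c i /\ c (i.+1 + n) = c i.+1 by [].
elim: i => [|i [IH1 IH2]].
  rewrite add0n c_n add1n; split=> //.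
  (* Both sides equal f_n + k (1 - f_{n-1}). *)
  by rewrite /n -cS c_last -/n c_n /c /kfib /= muln1 addn0; ring.
by split=> //; rewrite !addSn -cS -cS -addSn IH1 IH2.
Qed.

Let c_mod i : c (i %% n) = c i.
Proof.
rewrite [in RHS](divn_eq i n); elim: (i %/ n) => [|q IHq].
  by rewrite mul0n.
by rewrite mulSn -addnA addnC cDn.
Qed.

Lemma fib_x_neq1 : fib_x m.*2 <> 1%g.
Proof.
(* The group law of ['Z_L] is addition, so the relations become the recurrence [cS], with [c_mod]
   handling the wrap-around of indices. *)
pose f (i : 'I_n) : 'Z_L := c i.
have fR u v : fib_rel k u v -> word_eval f u = word_eval f v.
  case=> i [-> ->]; rewrite /word_eval big_cons big_seq1 /=.
  have fS (j : 'I_n) : f (ordS j) = c j.+1 by rewrite /f /= c_mod.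
  have -> : f (ordS (ordS i)) = c i.+2.
    have E : (i.+1 %% n).+1 = i.+2 %[mod n] by rewrite -addn1 modnDml addn1.
    by rewrite fS /= -c_mod E c_mod.
  rewrite -cS -fS; congr (_ + _).
  elim: k => [|j IHj] /=; first by rewrite big_nil mul0r.
  by rewrite big_cons IHj /= mulrS mulrDl mul1r.
move=> /(congr1 (pres_lift f)).
have -> : (1%g : G) = pres_class (@fib_rel k n) [::] by [].
have -> : fib_x m.*2 = pres_gen (@fib_rel k n) (ord_max : 'I_n).
  by rewrite -[pres_gen _ _]/(fib_gen k _) -fib_x_ord.
rewrite pres_lift_gen // pres_lift_class // /word_eval big_nil /f /= c_last.
move=> /(congr1 val); rewrite /= val_Zp_nat // modn_small ?cyclic_order_gt // => E.
by have := kfib_gt0 m.*2 k_gt0; rewrite E.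
Qed.

End Cyclic.

End FibGroup.

Theorem corollary5p4 (n k : nat) (n_ge3 : (3 <= n)%N) (n_odd : odd n)
    (k_ge1 : (1 <= k)%N) :
  [/\ normal_closure [set fib_w k n] = derived_subgroup (fib_group k n),
      fib_w k n = 1 <-> is_abelian (fib_group k n)
    & ~ torsion_free (fib_group k n)].
Proof.
have nE : n = (n./2).*2.+1 by rewrite -{1}(odd_double_half n) n_odd.
move: (n./2) nE => m nE; subst n; clear n_odd.
have m_gt0 : (0 < m)%N by lia.
have wcomm := fib_w_comm k m.
have w1_abelian : fib_w k m.*2.+1 = 1 -> is_abelian (fib_group k m.*2.+1).
  move=> w1 g h; apply/commgP/eqP.
  apply: (fib_comm_normal (is_normal_subgroup1 _)) => /=.
  by rewrite -wcomm w1 conj1g.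
split.
- apply/seteqP; split.
    apply: smallest_sub => [|_ ->]; first exact: derived_normal.
    have [_ DJ] := derived_normal (fib_group k m.*2.+1).
    rewrite -(conjgK (fib_x k m 0 ^+ k) (fib_w _ _)) wcomm.
    by apply: DJ; exact: derived_comm.
  move=> g Dg N [nN /(_ _ erefl) Nw]; have [_ NJ] := nN.
  apply: (derived_sub_normal nN) Dg => a b.
  by apply: (fib_comm_normal nN); rewrite -wcomm; exact: NJ.
- split=> // ab; apply: (conjg_inj (fib_x k m 0 ^+ k)).
  by rewrite wcomm conj1g; apply/eqP/commgP/ab.
- move=> tf.
  have /w1_abelian ab : fib_w k m.*2.+1 = 1.
    by apply: (tf _ 2); last exact: fib_w_sqr.
  apply: (fib_x_neq1 k_ge1 m_gt0).
  apply: (tf _ (kfib k m.*2 + kfib k m.*2.+2)%N).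
    by rewrite addn_gt0 kfib_gt0 ?orbT.
  (* [fib_seq_torsion] bounds the order of the term of index 0, so the sequence is shifted to start
     at x_{n-1}, the generator known to be nontrivial. *)
  pose y i := fib_x k m (m.*2 + i).
  have -> : fib_x k m m.*2 = y 0 by rewrite /y addn0.
  apply: fib_seq_torsion => [i||i]; rewrite /y.
  - by rewrite !addnS fib_xS.
  - exact: ab.
  - by rewrite addnA fib_xDn.
Qed.
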